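(* Let $n,T\ge1$, let $c_1,\ldots,c_T$ be positive reals and $z_1,z_2,\ldots$ positive reals. Consider the multispecies add-drop juggling Markov chain on $St_n^T$ described in the context. Its stationary distribution is given, for $w=w_1\cdots w_n\in St_n^T$, by $$\pi(w)=\frac1Z\prod_{i=1}^n c_{w_i}\,y_{E_w(i)},\qquad E_w(i)=1+\#\{j:\ i\le j\le n,\ w_j>w_i\},$$ where $$Z=\sum_{\substack{n_1+\cdots+n_T=n\\ n_i\ge 0}} c_1^{n_1}\cdots c_T^{n_T}\prod_{i=1}^T h_{n_i}\bigl(y_1,\ldots,y_{n-n_1-\cdots-n_i+1}\bigr),$$ with $h_\ell$ the complete homogeneous symmetric polynomial of degree $\ell$.
   Context: $St_n^T$ is the set of all words of length $n$ over $\{1,\ldots,T\}$. Let $y_i=z_1+\cdots+z_i$. For a word $u=u_1\cdots u_n$ set $u_{n+1}=\infty$ and $J_u(m,t)=1+\#\{\ell:\ m\le\ell\le n,\ u_\ell>t\}$ for $m\in\{1,\ldots,n+1\}$. A bumping sequence for $u$ is an increasing integer sequence $a(1)<\cdots<a(k)$ with $a(1)=1$, $a(k)=n+1$, $u_{a(j)}<u_{a(j+1)}$ for $1\le j\le k-1$; then $u^a$ is the word with $u^a_i=u_{a(\ell-1)}$ if $i=a(\ell)-1$ for some $\ell\in\{2,\ldots,k\}$ and $u^a_i=u_{i+1}$ otherwise. For $w\in St_n^T$ and $j\in\{1,\ldots,T\}$ let $u=jw_2\cdots w_n$. For a bumping sequence $a$ of $u$ define $$p_w(j,a)=\frac{c_j\,z_{J_u(a(2),j)}}{\sum_{t=1}^T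 c_t\,y_{J_u(2,t)}}\prod_{i=3}^k\frac{z_{J_u(a(i),u_{a(i-1)})}}{y_{J_u(a(i-1),u_{a(i-1)})}}.$$ The transition probability from $w$ to $w'$ is the sum of $p_w(j,a)$ over all pairs $(j,a)$ with $j\in\{1,\ldots,T\}$, $a$ a bumping sequence of $jw_2\cdots w_n$, and $(jw_2\cdots w_n)^a=w'$ (there is at most one such pair). *)

(* Defs.v *)
From HB Require Import structures.
From mathcomp Require Import all_boot all_order all_algebra.

Set Implicit Arguments.
Unset Strict Implicit.
Unset Printing Implicit Defensive.

Import Order.TTheory GRing.Theory Num.Theory.

Local Open Scope ring_scope.

(* Only the order of the letters matters: the letter t of {1, ..., T} is the
   ordinal t - 1 of 'I_T. *)
Definition word (n T : nat) : predArgType := n.-tuple 'I_T.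

(* u_i, with positions starting at 1.  Position n + 1 falls outside u, so it gets
   the default value T, which exceeds every letter and encodes u_{n+1} = oo. *)
Definition letter (n T : nat) (u : word n T) (i : nat) : nat :=
  nth T (map val u) i.-1.

Definition Jstat (n T : nat) (u : word n T) (m t : nat) : nat :=
  (1 + count (fun l => t < letter u l) (index_iota m n.+1))%N.

Definition Estat (n T : nat) (w : word n T) (i : nat) : nat :=
  (1 + count (fun j => letter w i < letter w j) (index_iota i n.+1))%N.

(* j w_2 ... w_n *)
Definition replace_first (n T : nat) (w : word n T) (j : 'I_T) : word n T :=
  [tuple if val i == 0%N then j else tnth w i | i < n].

(* a(i), with indices starting at 1 *)
Definition at_ (a : seq nat) (i : nat) : nat := nth 0%N a i.-1.

Definition bumping (n T : nat) (u : word n T) (a : seq nat) : bool :=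
  [&& sorted ltn a, at_ a 1 == 1%N, at_ a (size a) == n.+1
    & sorted (fun x y => letter u x < letter u y)%N a].

(* The i-th letter of u^a; at most one index l qualifies when a is increasing. *)
Definition bumped (n T : nat) (u : word n T) (a : seq nat) (i : nat) : nat :=
  if [pick l : 'I_(size a).+1 | (2 <= l)%N && (i == (at_ a l).-1)] is Some l
  then letter u (at_ a l.-1) else letter u i.+1.

Definition is_bumped (n T : nat) (u : word n T) (a : seq nat) (w' : word n T)
    : bool :=
  [forall i : 'I_n, letter w' i.+1 == bumped u a i.+1].

Section Chain.
Variables (R : realFieldType) (n T : nat).
(* The sequence z_1, z_2, ... ; the value z 0 is never used. *)
Variables (c : 'I_T -> R) (z : nat -> R).

Definition ysum (i : nat) : R := \sum_(1 <= k < i.+1) z k.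

Definition bump_weight (w : word n T) (j : 'I_T) (a : seq nat) : R :=
  let u := replace_first w j in
  c j * z (Jstat u (at_ a 2) j) / (\sum_(t < T) c t * ysum (Jstat u 2 t)) *
  \prod_(3 <= i < (size a).+1)
     (z (Jstat u (at_ a i) (letter u (at_ a i.-1))) /
      ysum (Jstat u (at_ a i.-1) (letter u (at_ a i.-1)))).

(* A bumping sequence is strictly increasing with values in {1, ..., n + 1}, so
   it has at most n + 1 terms, each of them an element of 'I_n.+2. *)
Definition add_drop (w w' : word n T) : R :=
  \sum_(j < T)
    \sum_(a : {bseq n.+1 of 'I_n.+2} |
            bumping (replace_first w j) (map val a) &&
            is_bumped (replace_first w j) (map val a) w')
      bump_weight w j (map val a).

(* h_l(x_1, ..., x_m), as the sum of all monomials of degree l *)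
Definition hsym (l m : nat) (x : nat -> R) : R :=
  \sum_(e : {ffun 'I_m -> 'I_l.+1} | (\sum_i e i)%N == l)
    \prod_(i < m) x i.+1 ^+ e i.

Definition Znorm : R :=
  \sum_(m : {ffun 'I_T -> 'I_n.+1} | (\sum_i m i)%N == n)
    (\prod_(i < T) c i ^+ m i) *
    \prod_(i < T) hsym (m i) (n - (\sum_(k < T | k <= i) m k) + 1)%N ysum.

Definition pi_add_drop (w : word n T) : R :=
  Znorm^-1 * \prod_(i < n) (c (tnth w i) * ysum (Estat w i.+1)).

End Chain.

Section Markov.
Variables (R : realFieldType) (S : finType).

Definition is_distribution (p : S -> R) : Prop :=
  (forall x, 0 <= p x) /\ \sum_x p x = 1.

Definition is_stochastic (P : S -> S -> R) : Prop :=
  forall x, is_distribution (P x).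

Definition is_stationary_distribution (P : S -> S -> R) (p : S -> R) : Prop :=
  is_distribution p /\ forall y, \sum_x p x * P x y = p y.

End Markov.

(* Main.v *)
Require Import Defs.
From mathcomp Require Import all_boot all_order all_algebra.
From mathcomp Require Import zify ring.
Import Order.TTheory GRing.Theory Num.Theory.
Set Implicit Arguments.
Unset Strict Implicit.
Unset Printing Implicit Defensive.
Local Open Scope ring_scope.

(** A bumping sequence sweeps the word from left to right while carrying a letter:
    at each later position, either the carried letter x is dropped and a larger
    letter y is picked up, or y moves one step to the left.  Summing the weights
    over all sweeps telescopes by y_{i+1} = y_i + z_{i+1}, which gives
    stochasticity.  For stationarity, summing pi(w) P(w, w') over w_1 cancels the
    denominator.  The remaining inflow Q_x(w') of sweeps that start with the
    letter x and produce w' satisfies, with E = E_{t w}(1),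
      Q_x(t w) = [x = t] c_t z_E sum_{y > t} Q_y(w) + c_t y_{E - [x > t]} Q_x(w),
    so sum_x Q_x(t w) = c_t y_E sum_x Q_x(w), again since y_E = y_{E-1} + z_E.
    The partition function is computed content by content: deleting the first
    letter gives a recursion that the product of complete homogeneous polynomials
    solves, by telescoping h_l(y_1..y_{M+1}) = h_l(y_1..y_M)
    + y_{M+1} h_{l-1}(y_1..y_{M+1}).  Uniqueness is irreducibility: every letter
    can be appended with positive probability. *)

(** * Uniqueness of the stationary distribution of an irreducible chain *)

Section StationaryUnique.
Variables (R : realFieldType) (S : finType) (P : S -> S -> R).

(** Irreducibility takes the form: a nonempty set closed under predecessors is everything.
    Subtracting from [p] the multiple of [pi] by the least ratio [p x / pi x] leaves a nonnegative
    invariant vector with a zero, and its zero set is closed in this sense. *)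
Lemma stationary_distribution_unique (pi p : S -> R) :
  (forall x y, 0 <= P x y) ->
  (forall A : pred S, (exists x, A x) ->
     (forall x y, A y -> 0 < P x y -> A x) -> forall x, A x) ->
  (forall x, 0 < pi x) ->
  is_stationary_distribution P pi -> is_stationary_distribution P p ->
  forall x, p x = pi x.
Proof.
move=> P0 irr pi0 [[_ spi] stpi] [[_ sp] stp].
have [x0 _] : exists x0 : S, true.
  apply/existsP; apply: contraT; rewrite negb_exists => /forallP no.
  have : (1 : R) != 0 by exact: oner_neq0.
  by rewrite -spi big1 ?eqxx // => i _; have := no i.
pose r x := p x / pi x.
have [x1 _ x1P] : exists2 x1, true & forall x, r x1 <= r x.
  case: (Order.TotalTheory.arg_minP r (isT : xpredT x0)) => i _ h.
  by exists i => // x; apply: h.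
pose l := r x1; pose q x := p x - l * pi x.
have q0 x : 0 <= q x.
  rewrite subr_ge0; have := x1P x; rewrite -/l /r => h.
  by rewrite -ler_pdivlMr.
have stq y : \sum_x q x * P x y = q y.
  rewrite /q -stp -(stpi y) mulr_sumr -sumrB.
  by apply: eq_bigr => x _; rewrite mulrBl mulrA.
have qx1 : q x1 = 0 by rewrite /q /l /r divfK ?subrr // gt_eqF.
have qz : forall x, q x == 0.
  apply: (irr (fun x => q x == 0)); first by exists x1; rewrite qx1.
  move=> x y /eqP qy Pxy.
  have := stq y; rewrite qy => /eqP.
  rewrite psumr_eq0 => [/allP /(_ x)|i _]; last by rewrite mulr_ge0.
  by rewrite mem_index_enum /= mulf_eq0 (gt_eqF Pxy) orbF => /(_ isT).
have pE x : p x = l * pi x by apply/eqP; rewrite -subr_eq0; apply: qz.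
have l1 : l = 1.
  by move: sp; under eq_bigr do rewrite pE; rewrite -mulr_sumr spi mulr1.
by move=> x; rewrite pE l1 mul1r.
Qed.

End StationaryUnique.

(** * Sweeps of a word, encoded by bit sequences *)

Lemma big_tuple_cons (V : nmodType) (A : finType) k (F : seq A -> V) :
  \sum_(t : k.+1.-tuple A) F t = \sum_x \sum_(t : k.-tuple A) F (x :: t).
Proof.
rewrite pair_big_dep /=.
rewrite (reindex (fun p : A * k.-tuple A => [tuple of p.1 :: p.2])) //=.
exists (fun t => (thead t, [tuple of behead t])) => [[x t]|t] _ /=.
  by congr pair; apply: val_inj.
by rewrite -tuple_eta.
Qed.

Lemma sum_delta (R : pzSemiRingType) (A : finType) (x : A) (a : R) :
  \sum_y (y == x)%:R * a = a.
Proof.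
rewrite (bigD1 x) //= eqxx big1 => [|i /negbTE ->]; last by rewrite mul0r.
by rewrite mul1r addr0.
Qed.

(* The word produced from x :: l by carrying x through l, with an exchange at each
   letter marked true in m. *)
Fixpoint carry (A : Type) (x : A) (l : seq A) (m : bitseq) : seq A :=
  match l, m with
  | y :: l', b :: m' => if b then x :: carry y l' m' else y :: carry x l' m'
  | _, _ => [:: x]
  end.

Lemma map_carry (A B : Type) (f : A -> B) x l m :
  map f (carry x l m) = carry (f x) (map f l) m.
Proof. by elim: l x m => [|y l IH] x [|[] m] //=; rewrite IH. Qed.

Lemma perm_carry (A : eqType) (x : A) l m :
  size m = size l -> perm_eq (carry x l m) (x :: l).
Proof.
elim: l x m => [|y l IH] x [|[] m] //= [sz]; first by rewrite perm_cons IH.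
by apply/permP => p /=; rewrite (permP (IH x m sz)) /= addnCA.
Qed.

Lemma carry_nseq_false (A : Type) (x : A) l k :
  k = size l -> carry x l (nseq k false) = rcons l x.
Proof. by move->; elim: l => //= y l ->. Qed.

(** Common form of [Jstat] and [Estat]. *)
Definition above (x : nat) (l : seq nat) : nat :=
  (1 + count (fun y => x < y)%N l)%N.

Lemma above_perm x l l' : perm_eq l l' -> above x l = above x l'.
Proof. by move=> /permP e; rewrite /above e. Qed.

Lemma above_cons x y l : above x (y :: l) = ((x < y)%N + above x l)%N.
Proof. by rewrite /above /= addnCA. Qed.

(** * Weights of words and of sweeps *)

Section Weights.
Variables (R : realFieldType) (T : nat) (c : 'I_T -> R) (z : nat -> R).
Hypothesis c_gt0 : forall t, 0 < c t.
Hypothesis z_gt0 : forall i, (1 <= i)%N -> 0 < z i.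
Local Notation Y := (ysum z).

Lemma ysumS i : Y i.+1 = Y i + z i.+1.
Proof. by rewrite /ysum big_nat_recr. Qed.

Lemma ysum1 : Y 1 = z 1%N.
Proof. by rewrite ysumS /ysum big_geq ?add0r. Qed.

Lemma ysum_gt0 i : (0 < i)%N -> 0 < Y i.
Proof.
elim: i => // -[_ _|i IH _]; first by rewrite ysum1 z_gt0.
by rewrite ysumS addr_gt0 ?IH ?z_gt0.
Qed.

Lemma ysum_above_gt0 x l : 0 < Y (above x l).
Proof. exact: ysum_gt0. Qed.

(* The product of the z's over y's of a sweep: the denominator attached to a letter
   appears when that letter is picked up, so the first carried letter has none. *)
Fixpoint carryw (x : nat) (l : seq nat) (m : bitseq) : R :=
  match l, m with
  | y :: l', b :: m' =>
      if b then z (above x (y :: l')) / Y (above y l') * carryw y l' m'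
      else carryw x l' m'
  | _, _ => z 1
  end.

Lemma carryw_gt0 x l m : 0 < carryw x l m.
Proof.
elim: l x m => [|y l IH] x [|[] m] //=; rewrite ?z_gt0 //.
by rewrite mulr_gt0 ?divr_gt0 ?z_gt0 ?ysum_above_gt0.
Qed.

(** An exchange at the first letter [y], possible only if [x < y], contributes
    [z (above x (y :: l))], its denominator being cancelled by induction; no exchange contributes
    [Y (above x l)]. *)
Lemma sum_carryw x l :
  \sum_(m : (size l).-tuple bool) (path ltn x (mask m l))%:R * carryw x l m
  = Y (above x l).
Proof.
elim: l x => [|y l IH] x.
  rewrite (big_pred1 [tuple]) => [|m]; first by rewrite /= mul1r /above addn0 ysum1.
  by rewrite [m]tuple0; apply/esym/eqP; apply: val_inj.
rewrite (big_tuple_cons _ (fun m =>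
  (path ltn x (mask m (y :: l)))%:R * carryw x (y :: l) m)).
rewrite big_bool /= IH.
under eq_bigr => m _.
  rewrite -mulnb natrM mulrACA.
  over.
rewrite -mulr_sumr IH -mulrA divfK; last by rewrite gt_eqF ?ysum_above_gt0.
rewrite above_cons; case: ltnP => _ /=; last by rewrite mul0r add0r.
by rewrite mul1r add1n ysumS addrC.
Qed.

(** The stationary weight before normalisation; a letter never exceeds itself, so [above] may start
    after [y]. *)
Fixpoint wordw (l : seq 'I_T) : R :=
  if l is y :: l' then c y * Y (above y (map val l')) * wordw l' else 1.

Lemma wordw_gt0 l : 0 < wordw l.
Proof. by elim: l => //= y l IH; rewrite !mulr_gt0 ?ysum_above_gt0. Qed.

(* Total weight, before normalisation, of the ways to produce the word s by
   bumping with first letter x. *)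
Definition inflow k (x : 'I_T) (s : seq 'I_T) : R :=
  \sum_(v : k.-tuple 'I_T) \sum_(m : k.-tuple bool)
    (path ltn x (mask m (map val v)) && (carry x v m == s))%:R *
    (c x * wordw v * carryw x (map val v) m).

Lemma inflow1 x t : inflow 0 x [:: t] = (x == t)%:R * (c t * Y 1).
Proof.
rewrite /inflow /=.
rewrite (big_pred1 [tuple]) => [|m]; last first.
  by rewrite [m]tuple0; apply/esym/eqP; apply: val_inj.
rewrite (big_pred1 [tuple]) => [|m]; last first.
  by rewrite [m]tuple0; apply/esym/eqP; apply: val_inj.
rewrite /= eqseq_cons andbT ysum1; case: eqVneq => [->|_]; last by rewrite !mul0r.
by rewrite mulr1.
Qed.

(* The two terms are the choices of bumping or not bumping at position 2. *)
Lemma inflow_cons k x t (s : seq 'I_T) : size s = k.+1 ->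
  inflow k.+1 x (t :: s) =
    (x == t)%:R * (c t * z (above t (map val s)) *
       \sum_(y : 'I_T | (t < y)%N) inflow k y s)
    + c t * Y (above t (map val s) - (t < x)%N) * inflow k x s.
Proof.
move=> sz.
pose G (v : seq 'I_T) := \sum_(m : k.+1.-tuple bool)
  (path ltn x (mask m (map val v)) && (carry x v m == t :: s))%:R *
  (c x * wordw v * carryw x (map val v) m).
have GE (y : 'I_T) (v : seq 'I_T) : G (y :: v) =
    \sum_(m : k.-tuple bool)
      ((x < y)%N && path ltn y (mask m (map val v)) && (x :: carry y v m == t :: s))%:R *
      (c x * wordw (y :: v) * (z (above x (val y :: map val v)) /
        Y (above y (map val v)) * carryw y (map val v) m)) +
    \sum_(m : k.-tuple bool)
      (path ltn x (mask m (map val v)) && (y :: carry x v m == t :: s))%:R *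
      (c x * wordw (y :: v) * carryw x (map val v) m).
  rewrite /G (big_tuple_cons _ (fun m =>
    (path ltn x (mask m (map val (y :: v))) && (carry x (y :: v) m == t :: s))%:R *
    (c x * wordw (y :: v) * carryw x (map val (y :: v)) m))).
  by rewrite big_bool.
rewrite -[LHS]/(\sum_(v : k.+1.-tuple 'I_T) G v) big_tuple_cons.
under [LHS]eq_bigr => y _ do under eq_bigr => v _ do rewrite GE.
clear GE G.
under [LHS]eq_bigr => y _ do rewrite big_split.
rewrite big_split; congr (_ + _).
  rewrite [in RHS]big_mkcond !mulr_sumr; apply: eq_bigr => y _.
  rewrite /inflow /=.
  case: (ltnP x y) => [xy|yx] /=; last first.
    rewrite big1; last by move=> v _; rewrite big1 // => m _; rewrite mul0r.
    case: eqVneq => [xt|_]; last by rewrite mul0r.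
    by rewrite -xt ltnNge yx !mulr0.
  under [LHS]eq_bigr do under eq_bigr do rewrite eqseq_cons.
  case: eqVneq => [xt|_] /=; last first.
    by rewrite mul0r big1 // => v _; rewrite big1 // => m _; rewrite andbF mul0r.
  rewrite -xt xy mul1r mulr_sumr; apply: eq_bigr => v _.
  rewrite [RHS]mulr_sumr; apply: eq_bigr => m _.
  case: eqP => [e|_]; last by rewrite andbF !mul0r mulr0.
  rewrite andbT.
  (* [carry] permutes the letters, so [y :: v] and [s] give the same statistic. *)
  have -> : above x (val y :: map val v) = above x (map val s).
    rewrite -e map_carry; apply: above_perm; rewrite perm_sym perm_carry //.
    by rewrite size_map !size_tuple.
  have := ysum_above_gt0 y (map val v); set yy := Y _ => yy0.
  have yy1 : yy != 0 by rewrite gt_eqF.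
  by field.
rewrite (bigD1 t) //= [X in _ + X]big1 ?addr0; last first.
  move=> y /negbTE yt; rewrite big1 // => v _; rewrite big1 // => m _.
  by rewrite eqseq_cons yt andbF mul0r.
rewrite /inflow mulr_sumr; apply: eq_bigr => v _.
rewrite [RHS]mulr_sumr; apply: eq_bigr => m _.
rewrite eqseq_cons eqxx /=.
case: eqP => [e|_]; last by rewrite andbF !mul0r mulr0.
(* [s] rearranges [x :: v]; the subtraction in the statement discards the contribution of [x]. *)
have -> : above t (map val s) = above t (val x :: map val v).
  rewrite -e map_carry; apply: above_perm; rewrite perm_carry //.
  by rewrite size_map !size_tuple.
by rewrite above_cons addKn; ring.
Qed.

Lemma sum_inflow k (s : seq 'I_T) : size s = k.+1 ->
  \sum_x inflow k x s = wordw s.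
Proof.
elim: s k => // t [_ [|//] _|s0 s IH [//|k] [sz]].
  under eq_bigr do rewrite inflow1.
  by rewrite sum_delta /= mulr1.
set s1 := s0 :: s; have sz1 : size s1 = k.+1 by rewrite /= sz.
rewrite -[RHS]/(c t * Y (above t (map val s1)) * wordw s1) -(IH k) //.
under [LHS]eq_bigr do rewrite (inflow_cons _ _ sz1).
set e := above _ _.
(* The first term survives only for [x = t]; each of its summands with [t < y] joins the second term
   for [y], by [Y (e - 1) + z e = Y e]. *)
rewrite big_split /= sum_delta mulr_sumr.
rewrite [X in X + _]big_mkcond -big_split mulr_sumr; apply: eq_bigr => x _ /=.
case: ltnP => _ /=; last by rewrite add0r subn0.
by rewrite {}/e /above !add1n subn1 /= ysumS; ring.
Qed.

End Weights.

(** * Complete homogeneous symmetric polynomials *)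

Section CompleteHomogeneous.
Variables (R : realFieldType) (x : nat -> R).

(** h_l(x_1, ..., x_m), split by the exponent [k] of the last variable to match the product rule for
    coefficients. *)
Fixpoint homog (m l : nat) : R :=
  if m is m'.+1 then \sum_(k < l.+1) x m'.+1 ^+ k * homog m' (l - k)
  else (l == 0%N)%:R.

Lemma homog0 m : homog m 0 = 1.
Proof. by elim: m => //= m IH; rewrite big_ord1 IH mulr1. Qed.

Lemma homogSS m l : homog m.+1 l.+1 = homog m l.+1 + x m.+1 * homog m.+1 l.
Proof.
rewrite /= big_ord_recl expr0 mul1r subn0 mulr_sumr; congr (_ + _).
by apply: eq_bigr => k _; rewrite lift0 subSS exprS mulrA.
Qed.

(** Generating function of the h_l; cutting the geometric series off after degree [B] does not
    affect coefficients up to [B]. *)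
Lemma coef_prod_geom B m l : (l <= B)%N ->
  (\prod_(i < m) \poly_(k < B.+1) (x i.+1 ^+ k))`_l = homog m l.
Proof.
elim: m l => [|m IH] l lB; first by rewrite big_ord0 coef1.
rewrite big_ord_recr /= coefMr; apply: eq_bigr => k _.
have kl := ltn_ord k; rewrite coef_poly IH; last by lia.
by rewrite mulrC ifT //; lia.
Qed.

Lemma hsymE l m : hsym l m x = homog m l.
Proof.
rewrite -(@coef_prod_geom l) //.
under [in RHS]eq_bigr do rewrite poly_def.
rewrite bigA_distr_bigA coef_sum /hsym big_mkcond; apply: eq_bigr => f _.
rewrite scaler_prod prodrXr coefZ coefXn eq_sym.
by case: eqP => _; rewrite ?mulr1 ?mulr0.
Qed.

End CompleteHomogeneous.

(** * The partition function, content by content *)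

Section PartitionFunction.
Variables (R : realFieldType) (T : nat) (c : 'I_T -> R) (z : nat -> R).
Local Notation Y := (ysum z).

Definition larger (m : 'I_T -> nat) (i : 'I_T) : nat :=
  (\sum_(s < T | i < s) m s)%N.

Let factor (i : 'I_T) (l M : nat) : R := c i ^+ l * homog Y M l.

(** The summand of [Znorm] for multiplicities [m]: when they add up to n, [larger m i] is n - m_1 -
    ... - m_i. *)
Definition content_weight (m : 'I_T -> nat) : R :=
  \prod_i factor i (m i) (larger m i).+1.

Definition remove (t : 'I_T) (m : 'I_T -> nat) (i : 'I_T) : nat :=
  (m i - (i == t))%N.

Lemma larger_remove t m i : (0 < m t)%N ->
  larger (remove t m) i = (larger m i - (i < t))%N.
Proof.
move=> mt; rewrite /larger; case: ltnP => it.
  rewrite (bigD1 t) //= [in RHS](bigD1 t) //= /remove eqxx.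
  rewrite (eq_bigr m) => [|s /andP[_ /negbTE ->]]; first by lia.
  by rewrite subn0.
rewrite subn0; apply: eq_bigr => s is_; rewrite /remove.
by case: eqP => [e|_]; rewrite ?subn0 //; move: is_; rewrite e; lia.
Qed.

Lemma content_weight_rec (m : 'I_T -> nat) : (exists i, 0 < m i)%N ->
  \sum_(t | (0 < m t)%N) c t * Y (larger m t).+1 * content_weight (remove t m)
  = content_weight m.
Proof.
move=> [i0 mi0].
(* Removing a letter t lowers by one the number of variables of the factors of
   all letters s < t, so the sum telescopes through A. *)
pose A (t : nat) := \prod_(s < T)
  factor s (m s) (if (s < t)%N then larger m s else (larger m s).+1).
(* The two [t]-th factors differ by one variable, and [homogSS] evaluates their difference; if
   [m t = 0] both are 1. *)
have term (t : 'I_T) :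
    (if (0 < m t)%N then c t * Y (larger m t).+1 * content_weight (remove t m)
     else 0) = A t - A t.+1.
  rewrite /A (bigD1 t) //= [X in _ - X](bigD1 t) //= ltnn ltnSn.
  rewrite [X in _ - _ * X](eq_bigr (fun s : 'I_T => factor s (m s)
    (if (s < t)%N then larger m s else (larger m s).+1))); last first.
    by move=> s st; rewrite ltnS leq_eqVlt (negbTE (st : val s != val t)).
  rewrite -mulrBl; case: ifP => [mt|/negbT]; last first.
    by rewrite -eqn0Ngt /factor => /eqP ->; rewrite !homog0 subrr mul0r.
  rewrite /content_weight (bigD1 t) //= mulrA; congr (_ * _).
    rewrite larger_remove // ltnn subn0 /remove eqxx.
    case: (m t) mt => // l _; rewrite subn1 /= /factor homogSS exprS.
    by ring.
  apply: eq_bigr => s st; rewrite larger_remove // /remove (negbTE st) subn0.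
  case: ltnP => sst; last by rewrite subn0.
  congr factor; rewrite subn1 prednK // /larger (bigD1 t) //=.
  by rewrite addn_gt0 mt.
rewrite big_mkcond; under eq_bigr do rewrite term.
rewrite -(big_mkord xpredT (fun t => A t - A t.+1)).
rewrite (eq_bigr (fun t => - (A t.+1 - A t))) => [|i _]; last by rewrite opprB.
rewrite sumrN telescope_sumr // opprB.
have -> : A 0%N = content_weight m by [].
suff -> : A T = 0 by rewrite subr0.
(* At the largest letter present [larger] is 0, and h of positive degree in no variables
   vanishes. *)
have [i mi imax] := @arg_maxnP _ i0 (fun i => 0 < m i)%N val mi0.
apply/eqP/prodf_eq0; exists i => //; rewrite ltn_ord.
rewrite /larger big1 => [|s is_]; last first.
  by apply/eqP; rewrite eqn0Ngt; apply/negP => /imax /=; lia.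
by rewrite /factor /=; case: (m i) mi => // l _; rewrite mulr0.
Qed.

(** Agreement is asked only above [t], so [m] may be the content of [t :: w]. *)
Lemma above_count (t : 'I_T) (w : seq 'I_T) (m : 'I_T -> nat) :
  (forall i : 'I_T, (t < i)%N -> count_mem i w = m i) ->
  above t (map val w) = (larger m t).+1.
Proof.
move=> wm; rewrite /above add1n /larger; congr S.
rewrite -(eq_bigr _ wm) {wm} count_map.
elim: w => [|y w IH] /=; first by rewrite big1.
rewrite IH big_split /=; congr addn.
rewrite big_mkcond (bigD1 y) //= eqxx big1 => [|i /negbTE iy].
  by rewrite addn0; case: (t < y)%N.
by rewrite eq_sym iy; case: ifP.
Qed.

Lemma sum_wordw_content k (m : 'I_T -> nat) : (\sum_i m i)%N = k ->
  \sum_(w : k.-tuple 'I_T | [forall i, count_mem i w == m i]) wordw c z w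
  = content_weight m.
Proof.
elim: k m => [|k IH] m sm.
  have m0 i : m i = 0%N.
    by apply/eqP; rewrite -leqn0 -sm (bigD1 i) //= leq_addr.
  rewrite (big_pred1 [tuple]) => [|w]; last first.
    rewrite [w]tuple0 [RHS](_ : _ = true); last by apply/eqP/val_inj.
    by apply/forallP => i; rewrite m0.
  by rewrite /content_weight big1 // => i _; rewrite m0 /factor homog0 mulr1.
rewrite -content_weight_rec; last first.
  apply/existsP; apply: contraT; rewrite negb_exists => /forallP no.
  by move: sm; rewrite big1 // => i _; apply/eqP; rewrite eqn0Ngt; exact: no.
rewrite big_mkcond (big_tuple_cons _ (fun w => if [forall i, count_mem i w == m i]
  then wordw c z w else 0)) [RHS]big_mkcond; apply: eq_bigr => t _.
case: ifP => [mt|/negbT mt]; last first.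
  rewrite big1 // => w _; case: ifP => // /forallP /(_ t) /=.
  by rewrite eqxx; case: (m t) mt.
rewrite -IH; last first.
  apply: succn_inj; rewrite -sm (bigD1 t) //= [in RHS](bigD1 t) //= {1}/remove eqxx.
  rewrite (eq_bigr m) => [|i /negbTE it]; first by move: mt; lia.
  by rewrite /remove it subn0.
rewrite [in RHS]big_mkcond mulr_sumr; apply: eq_bigr => w _.
have -> : [forall i, count_mem i (t :: w) == m i] =
          [forall i, count_mem i w == remove t m i].
  apply: eq_forallb => i; rewrite /remove /= (eq_sym t i).
  by case: (eqVneq i t) => [->|_] /=; [move: mt|]; lia.
case: ifP => [/forallP wm|_]; last by rewrite mulr0.
rewrite /= (@above_count _ _ m) // => i ti.
by rewrite (eqP (wm i)) /remove -val_eqE /= (gtn_eqF ti) subn0.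
Qed.

Lemma sum_count_mem_size (A : finType) (s : seq A) :
  (\sum_i count_mem i s)%N = size s.
Proof.
elim: s => [|y s IH]; first by rewrite big1.
rewrite /= big_split /= IH -add1n; congr addn.
by rewrite (bigD1 y) //= eqxx big1 // => i /negbTE; rewrite eq_sym => ->.
Qed.

Lemma ZnormE n : Znorm n c z = \sum_(w : n.-tuple 'I_T) wordw c z w.
Proof.
(* Counts are at most [n], so [inord] loses nothing. *)
pose ct (w : n.-tuple 'I_T) := [ffun i : 'I_T => inord (count_mem i w) : 'I_n.+1].
have ctE w i : ct w i = count_mem i w :> nat.
  by rewrite ffunE inordK // ltnS -[n in (_ <= n)%N](size_tuple w) count_size.
rewrite (partition_big ct (fun m => \sum_i m i == n)%N); last first.
  move=> w _; under eq_bigr do rewrite ctE.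
  by rewrite sum_count_mem_size size_tuple.
apply: eq_bigr => m /eqP sm.
rewrite (eq_bigl (fun w : n.-tuple 'I_T => [forall i, count_mem i w == m i])) => [|w].
  rewrite (sum_wordw_content sm) /content_weight big_split; congr (_ * _).
  apply: eq_bigr => i _; rewrite hsymE addn1; congr homog; congr S.
  rewrite -[RHS](addKn (\sum_(s < T | (s <= i)%N) m s)); congr (_ - _)%N.
  suff -> : (\sum_(s < T | (s <= i)%N) m s + larger (fun j => m j) i = n)%N by [].
  apply: etrans sm; rewrite [RHS](bigID (fun s : 'I_T => s <= i)%N); congr addn.
  by apply: eq_bigl => s; rewrite -ltnNge.
apply/eqP/forallP => [<- i|wm]; first by rewrite ctE.
by apply/ffunP => i; apply: val_inj; rewrite /= ctE; apply/eqP.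
Qed.

End PartitionFunction.

(** * Bumping sequences as sets of positions *)

(* The positions in [q, q + k) selected by m, followed by q + k; a bumping sequence
   of a word of length k + 1 is 1 :: positions 2 k m. *)
Definition positions (q k : nat) (m : bitseq) : seq nat :=
  rcons (mask m (iota q k)) (q + k)%N.

Lemma positions0 q m : positions q 0 m = [:: q].
Proof. by rewrite /positions mask0 addn0. Qed.

Lemma positions_cons q k b m :
  positions q k.+1 (b :: m) = nseq b q ++ positions q.+1 k m.
Proof. by rewrite /positions /= addSnnS; case: b. Qed.

Lemma mem_positions q k m p : p \in positions q k m -> (q <= p <= q + k)%N.
Proof.
rewrite /positions mem_rcons inE => /predU1P[->|]; first by rewrite leq_addr leqnn.
by move/mem_mask; rewrite mem_iota => /andP[-> /ltnW].
Qed.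

Lemma path_positions x q k m : (x < q)%N -> path ltn x (positions q k m).
Proof.
elim: k q x m => [|k IH] q x [|b m] xq; rewrite ?positions0 /= ?xq //.
  by rewrite /positions /= andbT; lia.
by rewrite positions_cons; case: b => /=; rewrite ?xq IH // ltnW.
Qed.

Fixpoint prev_in (x : nat) (s : seq nat) (p : nat) : nat :=
  if s is y :: s' then if p == y then x else prev_in y s' p else x.

Lemma prev_in_nth x s i : uniq s -> (i < size s)%N ->
  prev_in x s (nth 0%N s i) = nth 0%N (x :: s) i.
Proof.
elim: s x i => // y s IH x [|i] /= /andP[ys us]; rewrite ?eqxx // ltnS => lt_i.
have /negbTE -> : nth 0%N s i != y by apply: contra ys => /eqP <-; rewrite mem_nth.
exact: IH.
Qed.

Lemma bumped_prev_in n T (u : word n T) x s i :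
  path ltn x s ->
  bumped u (x :: s) i =
  letter u (if i.+1 \in s then prev_in x s i.+1 else i.+1).
Proof.
move=> xs.
have us : uniq s by have /andP[] := @sorted_uniq _ ltn ltn_trans ltnn (x :: s) xs.
(* Positivity lets [i = (at_ a l).-1] be read as [i.+1 = at_ a l]. *)
have spos p : p \in s -> (0 < p)%N.
  by move: xs; rewrite (path_sortedE ltn_trans) => /andP[/allP h _] /h;
  exact: leq_ltn_trans.
rewrite /bumped; case: pickP => [l /andP[l2 /eqP il]|none].
  case: l l2 il => -[|[|l]] //= ls _; rewrite /at_ /= => il.
  have iE : i.+1 = nth 0%N s l by rewrite il prednK // spos // mem_nth.
  by rewrite iE mem_nth // prev_in_nth.
case: ifP => // is_.
have is2 : ((index i.+1 s).+2 < (size s).+2)%N by rewrite !ltnS index_mem.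
by have := none (Ordinal is2); rewrite /at_ /= nth_index // eqxx.
Qed.

(** Bits mark the exchanges; at the endpoint [q + k], always in [s], the last carried letter is
    dropped. *)
Lemma carry_positions (A : Type) (U : nat -> A) x q k m :
  (x < q)%N -> size m = k ->
  let s := positions q k m in
  [seq U (if p \in s then prev_in x s p else p) | p <- iota q k.+1]
  = carry (U x) (map U (iota q k)) m.
Proof.
elim: k x q m => [|k IH] x q m xq.
  by move=> _; rewrite positions0 /= inE eqxx; case: m.
case: m => // b m [sz] s; rewrite {}/s positions_cons.
rewrite -[iota q k.+2]/(q :: iota q.+1 k.+1) map_cons.
have qN : q \notin positions q.+1 k m.
  by apply/negP => /mem_positions; rewrite ltnn.
case: b; rewrite [carry _ _ _]/= [nseq _ _ ++ _]/=.
  rewrite inE eqxx -(IH q q.+1 m) //= eqxx; congr cons.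
  apply/(@eq_in_map _ _ _ _ (iota q.+1 k.+1)) => p.
  by rewrite mem_iota => /andP[qp _]; rewrite inE gtn_eqF.
rewrite (negbTE qN) -(IH x q.+1 m) //; lia.
Qed.

(** * Translation of bumping and its weights into sweeps *)

Section Bridge.
Variables (R : realFieldType) (T k : nat) (c : 'I_T -> R) (z : nat -> R).
Local Notation Y := (ysum z).

Lemma replace_first_cons (v : k.-tuple 'I_T) (s j : 'I_T) :
  replace_first [tuple of s :: v] j = [tuple of j :: v].
Proof.
apply: eq_from_tnth => i; rewrite tnth_mktuple.
case: (unliftP ord0 i) => [i' ->|->]; last by rewrite !tnth0.
by rewrite !tnthS.
Qed.

Section FixedWord.
Variables (j : 'I_T) (v : k.-tuple 'I_T).
Let u : word k.+1 T := [tuple of j :: v].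

Lemma letter1 : letter u 1 = j. Proof. by []. Qed.

Lemma letter_iota : map (letter u) (iota 2 k) = map val v.
Proof.
apply: (@eq_from_nth _ T); first by rewrite !size_map size_iota size_tuple.
move=> i; rewrite size_map size_iota => ik.
by rewrite (nth_map 0%N) ?size_iota // nth_iota.
Qed.

Lemma letter_last : letter u k.+2 = T.
Proof. by rewrite /letter nth_default //= size_map size_tuple. Qed.

Lemma JstatE q l t : (q + l = k.+2)%N ->
  Jstat u q t = above t (map (letter u) (iota q l)).
Proof. by move=> e; rewrite /Jstat /above count_map /index_iota -e addKn. Qed.

Let a (m : bitseq) : seq nat := 1%N :: positions 2 k m.

Lemma bumping_positions m :
  bumping u (a m) = path ltn (val j) (mask m (map val v)).
Proof.
rewrite /bumping /a /= path_positions //.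
have -> : at_ (1%N :: positions 2 k m) (size (positions 2 k m)).+1 = k.+2.
  by rewrite /at_ /= /positions size_rcons /= nth_rcons ltnn eqxx.
rewrite eqxx -[path _ 1%N _](@path_map _ _ (letter u) ltn) letter1.
rewrite /positions map_rcons map_mask letter_iota letter_last.
(* The last comparison is with the default [T], which exceeds every letter. *)
rewrite rcons_path /=; apply: andb_idr => _.
have := mem_last (val j) (mask m (map val v)).
rewrite inE => /predU1P[->|/mem_mask /mapP[t _ ->]]; exact: ltn_ord.
Qed.

Lemma is_bumped_positions (m : k.-tuple bool) (w : word k.+1 T) :
  is_bumped u (a m) w = (carry j v m == w).
Proof.
have -> : (carry j v m == w) = (carry (val j) (map val v) m == map val w).
  by rewrite -map_carry (inj_eq (inj_map val_inj)).
have := @carry_positions _ (letter u) 1 2 k m erefl (size_tuple m).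
rewrite letter1 letter_iota => <-; set B := map _ _.
have szB : size B = k.+1 by rewrite size_map size_iota.
have nthB i : (i < k.+1)%N -> nth T B i = bumped u (a m) i.+1.
  move=> ik; rewrite (nth_map 0%N) ?size_iota // nth_iota // add2n.
  by rewrite bumped_prev_in // path_positions.
apply/forallP/eqP => [h|e i]; last by rewrite -nthB // e.
apply: (@eq_from_nth _ T) => [|i]; first by rewrite szB size_map size_tuple.
by rewrite szB => ik; rewrite nthB // -(eqP (h (Ordinal ik))).
Qed.

(** The product pairs the pick-up and the drop of one letter, [carryw] the pick-up and the drop at
    one position; the leading [z] is the pending drop of the letter at [x]. *)
Lemma chain_weight x q l m : (q + l = k.+2)%N -> size m = l ->
  let s := positions q l m in
  z (Jstat u (head 0%N s) (letter u x)) *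
  \prod_(p <- zip s (behead s))
    (z (Jstat u p.2 (letter u p.1)) / Y (Jstat u p.1 (letter u p.1)))
  = carryw z (letter u x) (map (letter u) (iota q l)) m.
Proof.
elim: l x q m => [|l IH] x q m ql.
  by move=> _; rewrite positions0 /= big_nil mulr1 (JstatE _ ql) /above.
case: m => // b m [sz] s; rewrite {}/s positions_cons.
have ql' : (q.+1 + l = k.+2)%N by rewrite addSnnS.
case: b => /=; last exact: IH.
have := IH q q.+1 m ql' sz.
case e : (positions q.+1 l m) => [|p s] /=.
  by have := congr1 size e; rewrite /positions size_rcons.
move=> <-; rewrite big_cons /= (JstatE _ ql) (JstatE (letter u q) ql) /=.
by rewrite [above (letter u q) _]above_cons ltnn add0n !mulrA; congr (_ * _); ring.
Qed.

Lemma bump_weight_positions s (m : k.-tuple bool) :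
  bump_weight c z [tuple of s :: v] j (a m) =
  c j / (\sum_t c t * Y (above t (map val v))) * carryw z j (map val v) m.
Proof.
rewrite /bump_weight replace_first_cons -/u.
have e2 : (2 + k = k.+2)%N by [].
under [X in _ / X]eq_bigr do rewrite (JstatE _ e2) letter_iota.
have := @chain_weight 1 2 k m e2 (size_tuple m); rewrite letter1 letter_iota => <-.
rewrite /a; case e : (positions 2 k m) => [|p s'].
  by have := congr1 size e; rewrite /positions size_rcons.
rewrite /= !mulrA; congr (_ * _); first by rewrite mulrAC.
rewrite big_add1 big_add1 big_add1 /= big_mkord.
elim: s' p {e} => [|p' s' IH] p; first by rewrite big_ord0 big_nil.
by rewrite big_ord_recl big_cons /= -IH.
Qed.

End FixedWord.
End Bridge.

(** A strictly increasing sequence from 1 to k + 2 is determined by which of 2, ..., k + 1 it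
    contains. *)
Lemma sum_positions (V : nmodType) k (P : pred (seq nat)) (F : seq nat -> V) :
  (forall a, P a -> [/\ sorted ltn a, at_ a 1 = 1%N & at_ a (size a) = k.+2]) ->
  \sum_(a : {bseq k.+2 of 'I_k.+3} | P (map val a)) F (map val a) =
  \sum_(m : k.-tuple bool | P (1%N :: positions 2 k m)) F (1%N :: positions 2 k m).
Proof.
move=> PP.
have szh (m : k.-tuple bool) :
    (size [seq inord p : 'I_k.+3 | p <- 1%N :: positions 2 k m] <= k.+2)%N.
  rewrite size_map /= size_rcons !ltnS.
  by have := size_subseq (mask_subseq m (iota 2 k)); rewrite size_iota.
pose h m : {bseq k.+2 of 'I_k.+3} := Bseq (szh m).
pose h' (a : {bseq k.+2 of 'I_k.+3}) : k.-tuple bool :=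
  [tuple i.+2 \in map val a | i < k].
have hE m : map val (h m) = 1%N :: positions 2 k m.
  rewrite /= -map_comp inordK //; congr cons; rewrite -[RHS]map_id.
  by apply/eq_in_map => p /mem_positions /andP[_ pk]; rewrite /= inordK.
have h'E (a : {bseq k.+2 of 'I_k.+3}) :
    h' a = [seq p \in map val a | p <- iota 2 k] :> seq bool.
  rewrite /= -[iota 2 k](@map_id nat) (iotaDl 2 0 k) -!map_comp -val_enum_ord -map_comp.
  by rewrite enumT; apply: eq_map.
rewrite (reindex_onto h h') => [|a /PP [sa a1 alast]]; last first.
  apply: val_inj; apply: (inj_map val_inj); rewrite hE.
  apply: (irr_sorted_eq ltn_trans ltnn) => //; first exact: path_positions.
  move=> p; rewrite inE /positions mem_rcons inE h'E -filter_mask mem_filter mem_iota.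
  have sz0 : (0 < size (map val a))%N by case: (map val a) alast.
  have m1 : 1%N \in map val a by rewrite -a1 mem_nth.
  have ml : at_ (map val a) (size (map val a)) \in map val a.
    by rewrite mem_nth // prednK.
  rewrite alast in ml.
  have [->|p1] := eqVneq p 1%N; first by rewrite m1.
  have [->|pk] := eqVneq p k.+2; first by rewrite ml orbT.
  rewrite /= andb_idr // => pa.
  have p0 : (0 < p)%N.
    move: sa a1 pa; case: (map val a) => // y s sa; rewrite /at_ /= => ->.
    rewrite inE => /predU1P[->//|]; move: sa => /=.
    by rewrite (path_sortedE ltn_trans) => /andP[/allP hs _] /hs;
    exact: leq_ltn_trans.
  have : (p < k.+3)%N by case/mapP: pa => i _ ->.
  lia.
apply: eq_big => [m|m _]; last by rewrite hE.
rewrite hE andb_idr // => _; apply/eqP/val_inj; apply: etrans (h'E _) _; rewrite hE.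
apply: (@eq_from_nth _ false); first by rewrite size_map size_iota size_tuple.
move=> i; rewrite size_map size_iota => ik.
rewrite (nth_map 0%N) ?size_iota // nth_iota // inE /positions mem_rcons inE.
rewrite in_mask ?iota_uniq // mem_iota.
have -> : index (2 + i)%N (iota 2 k) = i.
  by rewrite -[(2 + i)%N](nth_iota 0%N 2 ik) index_uniq ?iota_uniq ?size_iota.
by rewrite !eqn_add2l (ltn_eqF ik) ltn_add2l ik leq_addr.
Qed.

(** * Stochasticity, stationarity and irreducibility of the chain *)

Section Chain.
Variables (R : realFieldType) (T k : nat) (c : 'I_T -> R) (z : nat -> R).
Hypothesis c_gt0 : forall t, 0 < c t.
Hypothesis z_gt0 : forall i, (1 <= i)%N -> 0 < z i.
Local Notation Y := (ysum z).

Definition denom (v : seq 'I_T) : R := \sum_t c t * Y (above t (map val v)).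

Lemma denom_gt0 (t : 'I_T) v : 0 < denom v.
Proof.
rewrite /denom (bigD1 t) //= ltr_wpDr ?mulr_gt0 ?ysum_above_gt0 //.
by apply: sumr_ge0 => i _; rewrite mulr_ge0 // ltW // ysum_above_gt0.
Qed.

Lemma add_dropE (s : 'I_T) (v : k.-tuple 'I_T) (w : word k.+1 T) :
  add_drop c z [tuple of s :: v] w =
  \sum_j c j / denom v * \sum_(m : k.-tuple bool)
    (path ltn j (mask m (map val v)) && (carry j v m == w))%:R *
    carryw z j (map val v) m.
Proof.
rewrite /add_drop; apply: eq_bigr => j _; rewrite replace_first_cons.
set u : word k.+1 T := [tuple of j :: v].
rewrite (@sum_positions _ k (fun a => bumping u a && is_bumped u a w)
  (fun a => bump_weight c z [tuple of s :: v] j a)); last first.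
  by move=> a /andP[/and4P[sa /eqP a1 /eqP al _] _].
rewrite mulr_sumr big_mkcond; apply: eq_bigr => m _.
rewrite bumping_positions is_bumped_positions bump_weight_positions -/(denom v).
by case: ifP => _; rewrite ?mul1r ?mul0r ?mulr0.
Qed.

Lemma add_drop_ge0 (w w' : word k.+1 T) : 0 <= add_drop c z w w'.
Proof.
case/tupleP: w => s v; rewrite add_dropE; apply: sumr_ge0 => j _.
rewrite mulr_ge0 ?divr_ge0 ?(ltW (c_gt0 j)) ?(ltW (denom_gt0 j v)) //.
by apply: sumr_ge0 => m _; rewrite mulr_ge0 // ltW // carryw_gt0.
Qed.

(** Each sweep has exactly one result, so summing over targets removes that condition; by
    [sum_carryw] the numerators then add up to [denom v]. *)
Lemma sum_add_drop (w : word k.+1 T) : \sum_w' add_drop c z w w' = 1.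
Proof.
case/tupleP: w => s v; under eq_bigr do rewrite add_dropE.
rewrite exchange_big /=.
transitivity (\sum_j (c j * Y (above j (map val v))) / denom v); last first.
  by rewrite -mulr_suml divff // gt_eqF // (denom_gt0 s).
apply: eq_bigr => j _; rewrite -mulr_sumr mulrAC; congr (_ * _ / _).
have szv : size (map val v) = k by rewrite size_map size_tuple.
rewrite exchange_big -(@sum_carryw _ z) // szv; apply: eq_bigr => m _.
have szB : size (carry j v m) == k.+1.
  by rewrite (perm_size (perm_carry _ _)) /= ?size_tuple.
rewrite -[RHS](sum_delta (Tuple szB : word k.+1 T)); apply: eq_bigr => w' _.
by rewrite -val_eqE /= eq_sym; case: eqP => _; rewrite ?andbF ?andbT ?mul1r ?mul0r.
Qed.

Lemma letter_drop n (w : word n T) i :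
  map (letter w) (iota i.+1 (n - i)) = drop i (map val w).
Proof.
apply: (@eq_from_nth _ T); first by rewrite size_drop !size_map size_iota size_tuple.
move=> l; rewrite size_map size_iota => ln.
by rewrite (nth_map 0%N) ?size_iota // nth_iota // nth_drop.
Qed.

Lemma EstatE n (w : word n T) (i : 'I_n) :
  Estat w i.+1 = above (tnth w i) (map val (drop i.+1 w)).
Proof.
have lE : letter w i.+1 = tnth w i.
  by rewrite /letter /= (nth_map (tnth w i)) ?size_tuple // -tnth_nth.
have -> : Estat w i.+1 = above (letter w i.+1) (map (letter w) (iota i.+1 (n - i))).
  by rewrite /above count_map /Estat /index_iota subSS.
rewrite letter_drop (drop_nth T) ?size_map ?size_tuple // above_cons.
by rewrite -[nth _ _ _]/(letter w i.+1) ltnn lE -map_drop.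
Qed.

Lemma wordwE n (w : word n T) :
  \prod_(i < n) (c (tnth w i) * Y (Estat w i.+1)) = wordw c z w.
Proof.
under eq_bigr do rewrite EstatE.
elim: n w => [|n IH] w; first by rewrite big_ord0 [w]tuple0.
case/tupleP: w => x w; rewrite big_ord_recl tnth0 /= drop0 -IH; congr (_ * _).
by apply: eq_bigr => i _; rewrite tnthS.
Qed.

Lemma pi_add_dropE n (w : word n T) :
  pi_add_drop c z w = (Znorm n c z)^-1 * wordw c z w.
Proof. by rewrite /pi_add_drop wordwE. Qed.

Lemma Znorm_gt0 n : (0 < T)%N -> 0 < Znorm n c z.
Proof.
move=> T0; rewrite ZnormE (bigD1 [tuple of nseq n (Ordinal T0)]) //=.
rewrite ltr_wpDr ?wordw_gt0 //.
by apply: sumr_ge0 => i _; rewrite ltW // wordw_gt0.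
Qed.

(** Transitions out of [s :: v] do not depend on [s], and these words have total weight
    [denom v * wordw c z v]; the denominators cancel and [sum_inflow] applies. *)
Lemma wordw_stationary (w' : word k.+1 T) :
  \sum_(w : word k.+1 T) wordw c z w * add_drop c z w w' = wordw c z w'.
Proof.
rewrite -(@sum_inflow _ _ c z _ k) ?size_tuple //.
pose A (v : seq 'I_T) := \sum_j c j / denom v * \sum_(m : k.-tuple bool)
    (path ltn j (mask m (map val v)) && (carry j v m == w'))%:R *
    carryw z j (map val v) m.
transitivity (\sum_(w : k.+1.-tuple 'I_T) wordw c z w * A (behead w)).
  by apply: eq_bigr => w _; case/tupleP: w => s v; rewrite add_dropE.
rewrite (big_tuple_cons _ (fun w => wordw c z w * A (behead w))).
rewrite exchange_big [RHS]exchange_big; apply: eq_bigr => v _ /=.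
transitivity (denom v * (wordw c z v * A v)).
  by rewrite [in RHS]/denom mulr_suml; apply: eq_bigr => s _; rewrite !mulrA.
rewrite /A !mulr_sumr; apply: eq_bigr => j _.
rewrite !mulr_sumr; apply: eq_bigr => m _.
have d0 : denom v != 0 by rewrite gt_eqF // (denom_gt0 j).
by field.
Qed.

(** The sweep without exchanges, with bumping sequence 1 < k + 2, carries [j] past all of [v] and
    has positive weight. *)
Lemma add_drop_append_gt0 (s j : 'I_T) (v : k.-tuple 'I_T) (w : word k.+1 T) :
  w = rcons v j :> seq 'I_T -> 0 < add_drop c z [tuple of s :: v] w.
Proof.
move=> wE; rewrite add_dropE (bigD1 j) //= (bigD1 [tuple of nseq k false]) //=.
rewrite mask_false carry_nseq_false ?size_tuple // wE eqxx mul1r.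
apply: ltr_wpDr.
  apply: sumr_ge0 => i _.
  rewrite mulr_ge0 ?divr_ge0 ?(ltW (c_gt0 i)) ?(ltW (denom_gt0 i v)) //.
  by apply: sumr_ge0 => m _; rewrite mulr_ge0 // ltW // carryw_gt0.
rewrite mulr_gt0 ?divr_gt0 ?(denom_gt0 j) //; apply: ltr_wpDr.
  by apply: sumr_ge0 => m _; rewrite mulr_ge0 // ltW // carryw_gt0.
exact: carryw_gt0.
Qed.

(* Appending the letters of a target word one at a time reaches it in k + 1
   steps from anywhere. *)
Lemma add_drop_irreducible (A : pred (word k.+1 T)) :
  (exists w, A w) ->
  (forall w w', A w' -> 0 < add_drop c z w w' -> A w) -> forall w, A w.
Proof.
move=> [w0 Aw0] back w.
(* Here [i] counts the letters of [w0] still to be appended. *)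
suff H i : (i <= k.+1)%N -> forall w : word k.+1 T,
    drop i w = take (k.+1 - i) w0 -> A w.
  by apply: (H k.+1) => //; rewrite subnn take0 drop_oversize ?size_tuple.
elim: i => [_ w1|i IH ik {}w].
  by rewrite drop0 subn0 take_oversize ?size_tuple // => /val_inj ->.
case/tupleP: w => s v /= dv.
pose j := nth s w0 (k - i).
apply: back (@add_drop_append_gt0 s j v [tuple of rcons v j] erefl).
apply: IH; first exact: ltnW.
rewrite /= drop_rcons ?size_tuple // dv /j subSS -take_nth ?size_tuple; last by lia.
by rewrite subSn.
Qed.

End Chain.

Theorem theorem3p3 (R : realFieldType) (n T : nat)
    (hn : (1 <= n)%N) (hT : (1 <= T)%N)
    (c : 'I_T -> R) (hc : forall t : 'I_T, 0 < c t)
    (z : nat -> R) (hz : forall i : nat, (1 <= i)%N -> 0 < z i) :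
  is_stochastic (@add_drop R n T c z) /\
  is_stationary_distribution (@add_drop R n T c z) (@pi_add_drop R n T c z) /\
  (forall p : word n T -> R,
     is_stationary_distribution (@add_drop R n T c z) p ->
     forall w : word n T, p w = @pi_add_drop R n T c z w).
Proof.
case: n hn => // k _.
have pi_gt0 (w : word k.+1 T) : 0 < pi_add_drop c z w.
  by rewrite pi_add_dropE mulr_gt0 ?invr_gt0 ?Znorm_gt0 ?wordw_gt0.
have pi_st : is_stationary_distribution (@add_drop R k.+1 T c z) (pi_add_drop c z).
  split; first split=> [w|]; first exact: ltW.
    under eq_bigr do rewrite pi_add_dropE.
    by rewrite -mulr_sumr -ZnormE mulVf // gt_eqF // Znorm_gt0.
  move=> w'; rewrite pi_add_dropE -wordw_stationary // mulr_sumr.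
  by apply: eq_bigr => w _; rewrite pi_add_dropE mulrA.
split; first by move=> w; split; [move=> w'; exact: add_drop_ge0|exact: sum_add_drop].
split=> // p; apply: stationary_distribution_unique pi_st => //.
  by move=> w w'; apply: add_drop_ge0.
by move=> A; apply: add_drop_irreducible.
Qed.
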